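(* Let $R$ be a commutative unital ring and let $I$ be any ideal of $R$. For any two $R$-modules $M$ and $N$, where $M$ is $I$-coreduced, we have $$\Gamma_I(\mathrm{Hom}_R(M,N))\cong \mathrm{Hom}_R(\Lambda_I(M), N)\quad\text{and}\quad \Gamma_I(D(M))\cong D(\Lambda_I(M)).$$
   Context: The $I$-torsion functor is $\Gamma_I(M):=\varinjlim_k \mathrm{Hom}_R(R/I^k, M)$ and the $I$-adic completion functor is $\Lambda_I(M):=\varprojlim_k M/I^kM$. For $a\in R$ let $f_a:M\to M$ be $m\mapsto am$ and $f_a^2=f_a\circ f_a$; $M$ is $I$-coreduced if $\mathrm{Coker} f_a\cong \mathrm{Coker} f_a^2$ for every $a\in I$. $E$ denotes the direct product of the injective hulls $E_R(R/\mathfrak{m})$ of the $R$-modules $R/\mathfrak m$, where $\mathfrak m$ runs through the maximal ideals of $R$ (an injective cogenerator of $R\text{-Mod}$), and $D(-):=\mathrm{Hom}_R(-,E)$ is the general Matlis duality functor. *)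

(* Defs.v *)
From HB Require Import structures.
From mathcomp Require Import all_boot all_algebra.
From mathcomp Require Import boolp classical_sets.

Set Implicit Arguments.
Unset Strict Implicit.
Unset Printing Implicit Defensive.

Import GRing.Theory.
Local Open Scope ring_scope.
Local Open Scope quotient_scope.

(* Submodules and ideals are boolean predicates.  This loses no generality,    *)
(* since the axioms of boolp turn any [P : V -> Prop] into [fun v => `[<P v>]].  *)
(* [R] ranges over [comPzRingType], so the zero ring is allowed.               *)
Notation submodule V := (submodClosed V).
Notation ideal R := (submodClosed R^o).

Definition lmod_isom (R : pzRingType) (M N : lmodType R) : Prop :=
  exists f : {linear M -> N}, bijective f.

Lemma submodule_ext (R : pzRingType) (V : lmodType R) (S T : submodule V) :
  S =i T -> S = T.
Proof.
case: S T => [S [[S1] [S2]]] [T [[T1] [T2]]] eST.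
have e : S = T by apply/funext => x; exact: eST.
subst T; congr (GRing.SubmodClosed.Pack _).
by rewrite (Prop_irrelevance S1 T1) (Prop_irrelevance S2 T2).
Qed.

Section Submodules.
Variables (R : pzRingType) (V : lmodType R).

Definition full_pred : {pred V} := fun=> true.

Lemma full_closed : GRing.subsemimod_closed full_pred.
Proof. by []. Qed.

Definition fullM : submodule V := HB.pack full_pred
  (GRing.isSubmodClosed.Build R V full_pred full_closed).

(* The submodule generated by S: the smallest submodule containing S. *)
Definition span_pred (S : set V) : {pred V} :=
  fun v => `[< forall W : submodule V, (forall w, S w -> w \in W) -> v \in W >].

Lemma span_closed S : GRing.subsemimod_closed (span_pred S).
Proof.
split; first split=> [|x y /asboolP hx /asboolP hy].
- by apply/asboolP => W _; rewrite rpred0.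
- by apply/asboolP => W hW; rewrite rpredD ?hx ?hy.
- by move=> a x /asboolP hx; apply/asboolP => W hW; rewrite rpredZ ?hx.
Qed.

Definition spanM (S : set V) : submodule V := HB.pack (span_pred S)
  (GRing.isSubmodClosed.Build R V (span_pred S) (span_closed S)).

Lemma mem_spanM (S : set V) v : S v -> v \in spanM S.
Proof. by move=> Sv; apply/asboolP => W; apply. Qed.

Lemma spanM_sub (S : set V) (W : submodule V) :
  (forall w, S w -> w \in W) -> {subset spanM S <= W}.
Proof. by move=> SW v /asboolP; apply. Qed.

Definition idealM (I : ideal R) (W : submodule V) : submodule V :=
  spanM [set v | exists a w, [/\ a \in I, w \in W & v = a *: w]].

Lemma idealM_sub (I : ideal R) (W : submodule V) : {subset idealM I W <= W}.
Proof. by apply: spanM_sub => _ [a [w [_ wW ->]]]; rewrite rpredZ. Qed.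

Lemma idealMS (I J : ideal R) (W : submodule V) :
  {subset I <= J} -> {subset idealM I W <= idealM J W}.
Proof.
move=> sIJ; apply: spanM_sub => _ [a [w [aI wW ->]]].
by apply: mem_spanM; exists a, w; split; rewrite ?sIJ.
Qed.

End Submodules.
Arguments fullM {R} V.

Definition idealX (R : pzRingType) (I : ideal R) (k : nat) : ideal R :=
  iter k (idealM I) (fullM R^o).

Lemma idealX_sub (R : pzRingType) (I : ideal R) k :
  {subset idealX I k.+1 <= idealX I k}.
Proof. exact: idealM_sub. Qed.

Section QuotientModule.
Variables (R : pzRingType) (V : lmodType R) (W : submodule V).

Definition submodule_pred : {pred V} := W.
HB.instance Definition _ := GRing.isZmodClosed.Build V submodule_pred
  (GRing.subsemimod_closedB (GRing.subsemimodClosedP W)).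

Definition quotM : Type := Quotient.quot submodule_pred.
HB.instance Definition _ := GRing.Zmodule.on quotM.
HB.instance Definition _ := EqQuotient.on quotM.

Lemma quotM_eq (x y : V) : (\pi_quotM x == \pi_quotM y) = (x - y \in W).
Proof. by rewrite (Quotient.idealrBE submodule_pred). Qed.

Lemma quotM_piD (x y : V) : \pi_quotM (x + y) = \pi_quotM x + \pi_quotM y.
Proof. exact: (raddfD (\pi_(Quotient.quot submodule_pred))). Qed.

Definition scaleq (a : R) (x : quotM) : quotM := \pi_quotM (a *: repr x).

Lemma scaleq_pi a (v : V) : scaleq a (\pi_quotM v) = \pi_quotM (a *: v).
Proof.
apply/eqP; rewrite quotM_eq -scalerBr; apply: rpredZ.
by rewrite -quotM_eq reprK.
Qed.

Fact scaleqA a b x : scaleq a (scaleq b x) = scaleq (a * b) x.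
Proof. by elim/quotW: x => v; rewrite (scaleq_pi b) !scaleq_pi scalerA. Qed.
Fact scaleq1 : left_id 1 scaleq.
Proof. by elim/quotW=> v; rewrite scaleq_pi scale1r. Qed.
Fact scaleqDr : right_distributive scaleq +%R.
Proof.
move=> a; elim/quotW=> v; elim/quotW=> w.
by rewrite -quotM_piD 3!scaleq_pi scalerDr quotM_piD.
Qed.
Fact scaleqDl x : {morph scaleq^~ x : a b / a + b}.
Proof.
by elim/quotW: x => v a b; rewrite 3!scaleq_pi scalerDl quotM_piD.
Qed.

HB.instance Definition _ := GRing.Zmodule_isLmodule.Build R quotM
  scaleqA scaleq1 scaleqDr scaleqDl.

Lemma quotM_piZ a (x : V) : \pi_quotM (a *: x) = a *: \pi_quotM x.
Proof. by rewrite -scaleq_pi. Qed.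

End QuotientModule.

(* The canonical map V/W -> V/W' for W contained in W'. *)
Section QuotientProjection.
Variables (R : pzRingType) (V : lmodType R) (W W' : submodule V).
Hypothesis sWW' : {subset W <= W'}.

Definition quot_proj_fun (x : quotM W) : quotM W' := \pi_(quotM W') (repr x).

Lemma quot_proj_pi (v : V) :
  quot_proj_fun (\pi_(quotM W) v) = \pi_(quotM W') v.
Proof. by apply/eqP; rewrite quotM_eq; apply: sWW'; rewrite -quotM_eq reprK. Qed.

Fact quot_proj_linear : linear quot_proj_fun.
Proof.
move=> a; elim/quotW=> v; elim/quotW=> w.
by rewrite -quotM_piZ -quotM_piD 3!quot_proj_pi quotM_piD quotM_piZ.
Qed.

Definition quot_proj : {linear quotM W -> quotM W'} := HB.pack quot_proj_fun
  (GRing.isLinear.Build R (quotM W) (quotM W') *:%R quot_proj_fun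
     quot_proj_linear).

End QuotientProjection.

Section HomModule.
Variables (R : comPzRingType) (M N : lmodType R).

Definition homR : Type := {linear M -> N}.
HB.instance Definition _ := gen_eqMixin homR.
HB.instance Definition _ := gen_choiceMixin homR.
Implicit Types f g h : homR.

Lemma Hom_ext f g : f =1 g -> f = g.
Proof.
case: f g => [f [[f1] [f2]]] [g [[g1] [g2]]] /= efg.
have e : f = g by apply/funext.
subst g; congr (GRing.Linear.Pack _).
by rewrite (Prop_irrelevance f1 g1) (Prop_irrelevance f2 g2).
Qed.

Definition zeroH : homR := (\0 : {linear M -> N}).
Definition oppH f : homR := (\- (f : {linear M -> N}) : {linear M -> N}).
Definition addH f g : homR :=
  ((f : {linear M -> N}) \+ (g : {linear M -> N}) : {linear M -> N}).
Definition scaleH (a : R) f : homR :=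
  (a \*: (f : {linear M -> N}) : {linear M -> N}).

Fact addHA : associative addH.
Proof. by move=> f g h; apply: Hom_ext => x /=; rewrite addrA. Qed.
Fact addHC : commutative addH.
Proof. by move=> f g; apply: Hom_ext => x /=; rewrite addrC. Qed.
Fact add0H : left_id zeroH addH.
Proof. by move=> f; apply: Hom_ext => x /=; rewrite add0r. Qed.
Fact addNH : left_inverse zeroH oppH addH.
Proof. by move=> f; apply: Hom_ext => x /=; rewrite addNr. Qed.
HB.instance Definition _ :=
  GRing.isZmodule.Build homR addHA addHC add0H addNH.

Fact scaleHA a b f : scaleH a (scaleH b f) = scaleH (a * b) f.
Proof. by apply: Hom_ext => x /=; rewrite scalerA. Qed.
Fact scale1H : left_id 1 scaleH.
Proof. by move=> f; apply: Hom_ext => x /=; rewrite scale1r. Qed.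
Fact scaleHDr : right_distributive scaleH +%R.
Proof. by move=> a f g; apply: Hom_ext => x /=; rewrite scalerDr. Qed.
Fact scaleHDl f : {morph scaleH^~ f : a b / a + b}.
Proof. by move=> a b; apply: Hom_ext => x /=; rewrite scalerDl. Qed.
HB.instance Definition _ := GRing.Zmodule_isLmodule.Build R homR
  scaleHA scale1H scaleHDr scaleHDl.

End HomModule.

Section Precomposition.
Variables (R : comPzRingType) (A B M : lmodType R) (p : {linear A -> B}).

Definition precomp_fun (f : homR B M) : homR A M :=
  ((f : {linear B -> M}) \o p : {linear A -> M}).

Fact precomp_linear : linear precomp_fun.
Proof. by move=> a f g; apply: Hom_ext. Qed.

Definition precomp : {linear homR B M -> homR A M} := HB.pack precomp_fun
  (GRing.isLinear.Build R (homR B M) (homR A M) *:%R precomp_fun precomp_linear).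

End Precomposition.

Section ProductModule.
Variables (R : pzRingType) (T : Type) (M : T -> lmodType R).

Definition prodM : Type := forall t, M t.
HB.instance Definition _ := gen_eqMixin prodM.
HB.instance Definition _ := gen_choiceMixin prodM.
Implicit Types x y z : prodM.

Lemma prodM_ext x y : (forall t, x t = y t) -> x = y.
Proof. exact: functional_extensionality_dep. Qed.

Definition zeroP : prodM := fun t => 0.
Definition oppP x : prodM := fun t => - x t.
Definition addP x y : prodM := fun t => x t + y t.
Definition scaleP (a : R) x : prodM := fun t => a *: x t.

Fact addPA : associative addP.
Proof. by move=> x y z; apply: prodM_ext => t; rewrite /addP addrA. Qed.
Fact addPC : commutative addP.
Proof. by move=> x y; apply: prodM_ext => t; rewrite /addP addrC. Qed.
Fact add0P : left_id zeroP addP.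
Proof. by move=> x; apply: prodM_ext => t; rewrite /addP add0r. Qed.
Fact addNP : left_inverse zeroP oppP addP.
Proof. by move=> x; apply: prodM_ext => t; rewrite /addP addNr. Qed.
HB.instance Definition _ := GRing.isZmodule.Build prodM addPA addPC add0P addNP.

Fact scalePA a b x : scaleP a (scaleP b x) = scaleP (a * b) x.
Proof. by apply: prodM_ext => t; rewrite /scaleP scalerA. Qed.
Fact scale1P : left_id 1 scaleP.
Proof. by move=> x; apply: prodM_ext => t; rewrite /scaleP scale1r. Qed.
Fact scalePDr : right_distributive scaleP +%R.
Proof. by move=> a x y; apply: prodM_ext => t; rewrite /scaleP scalerDr. Qed.
Fact scalePDl x : {morph scaleP^~ x : a b / a + b}.
Proof. by move=> a b; apply: prodM_ext => t; rewrite /scaleP scalerDl. Qed.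
HB.instance Definition _ := GRing.Zmodule_isLmodule.Build R prodM
  scalePA scale1P scalePDr scalePDl.

Lemma prodM_addE x y t : (x + y) t = x t + y t. Proof. by []. Qed.
Lemma prodM_scaleE a x t : (a *: x) t = a *: x t. Proof. by []. Qed.

End ProductModule.

(* The limit of ... -> M 2 -> M 1 -> M 0: coherent sequences in the product. *)
Section InverseLimit.
Variables (R : pzRingType) (M : nat -> lmodType R).
Variable u : forall k, {linear M k.+1 -> M k}.

Definition coherent : {pred prodM M} :=
  fun x => `[< forall k, u k (x k.+1) = x k >].

Fact coherent_closed : GRing.subsemimod_closed coherent.
Proof.
split; first split=> [|x y /asboolP hx /asboolP hy].
- by apply/asboolP => k; rewrite linear0.
- by apply/asboolP => k; rewrite linearD hx hy.
- by move=> a x /asboolP hx; apply/asboolP => k; rewrite linearZ hx.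
Qed.
HB.instance Definition _ :=
  GRing.isSubmodClosed.Build R (prodM M) coherent coherent_closed.

Record invlim : Type := InvLim {invlim_val : prodM M; _ : invlim_val \in coherent}.
HB.instance Definition _ := [isSub for invlim_val].
HB.instance Definition _ := [Choice of invlim by <:].
HB.instance Definition _ := [SubChoice_isSubLmodule of invlim by <:].

End InverseLimit.

(* The colimit of M 0 -> M 1 -> M 2 -> ...: the direct sum of the M k modulo   *)
(* the submodule generated by the x - u_k(x) for x in M k.                     *)
Section DirectLimit.
Variables (R : pzRingType) (M : nat -> lmodType R).

Definition finsupp : {pred prodM M} :=
  fun x => `[< exists n, forall k, (n <= k)%N -> x k = 0 >].

Fact finsupp_closed : GRing.subsemimod_closed finsupp.
Proof.
split; first split=> [|x y /asboolP[m hx] /asboolP[n hy]].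
- by apply/asboolP; exists 0%N.
- apply/asboolP; exists (maxn m n) => k; rewrite geq_max => /andP[mk nk].
  by rewrite prodM_addE hx // hy // addr0.
- move=> a x /asboolP[m hx]; apply/asboolP; exists m => k mk.
  by rewrite prodM_scaleE hx // scaler0.
Qed.
HB.instance Definition _ :=
  GRing.isSubmodClosed.Build R (prodM M) finsupp finsupp_closed.

Record dsumM : Type := DSum {dsumM_val : prodM M; _ : dsumM_val \in finsupp}.
HB.instance Definition _ := [isSub for dsumM_val].
HB.instance Definition _ := [Choice of dsumM by <:].
HB.instance Definition _ := [SubChoice_isSubLmodule of dsumM by <:].

Fact dsum_inj_subproof k (x : M k) :
  (dfwith (0 : prodM M) x : prodM M) \in finsupp.
Proof.
apply/asboolP; exists k.+1 => j kj.
by rewrite dfwith_out // neq_ltn kj.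
Qed.

Definition dsum_inj k (x : M k) : dsumM := DSum (dsum_inj_subproof x).

Variable u : forall k, {linear M k -> M k.+1}.

Definition dirlim_rel : submodule dsumM :=
  spanM [set y | exists k (x : M k), y = dsum_inj x - dsum_inj (u k x)].

Definition dirlim : lmodType R := quotM dirlim_rel.

End DirectLimit.

Section Functors.
Variables (R : comPzRingType) (I : ideal R).

Definition torsion_functor (M : lmodType R) : lmodType R :=
  @dirlim R (fun k => homR (quotM (idealX I k)) M)
    (fun k => precomp M (quot_proj (@idealX_sub R I k))).

Definition completion_functor (M : lmodType R) : lmodType R :=
  @invlim R (fun k => quotM (idealM (idealX I k) (fullM M)))
    (fun k => quot_proj (idealMS (W := fullM M) (@idealX_sub R I k))).

End Functors.

Section Cokernel.
Variables (R : pzRingType) (A B : lmodType R) (f : {linear A -> B}).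

Definition im_pred : {pred B} := fun y => `[< exists x, y = f x >].

Fact im_closed : GRing.subsemimod_closed im_pred.
Proof.
split; first split=> [|_ _ /asboolP[x ->] /asboolP[y ->]].
- by apply/asboolP; exists 0; rewrite linear0.
- by apply/asboolP; exists (x + y); rewrite linearD.
- by move=> a _ /asboolP[x ->]; apply/asboolP; exists (a *: x); rewrite linearZ.
Qed.

Definition imM : submodule B := HB.pack im_pred
  (GRing.isSubmodClosed.Build R B im_pred im_closed).

Definition cokerM : lmodType R := quotM imM.

End Cokernel.

Section Coreduced.
Variables (R : comPzRingType) (I : ideal R) (M : lmodType R).

Definition homothety_fun (a : R) (m : M) : M := a *: m.

Fact homothety_linear a : linear (homothety_fun a).
Proof.
by move=> b x y; rewrite /homothety_fun scalerDr !scalerA mulrC.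
Qed.

Definition homothety (a : R) : {linear M -> M} := HB.pack (homothety_fun a)
  (GRing.isLinear.Build R M M *:%R (homothety_fun a) (homothety_linear a)).

Definition coreduced : Prop :=
  forall a, a \in I ->
    lmod_isom (cokerM (homothety a)) (cokerM (homothety a \o homothety a)).

End Coreduced.

Section MatlisDuality.
Variable R : comPzRingType.

(* By [submodule_ext] and proof irrelevance, extensionally equal maximal ideals *)
(* are equal, so a family indexed by this type has one member per ideal.        *)
Record maximal_ideal : Type := MaximalIdeal {
  max_ideal :> ideal R;
  _ : exists x : R^o, x \notin max_ideal;
  _ : forall J : ideal R, {subset max_ideal <= J} ->
        J =i max_ideal \/ J =i fullM R^o }.

Definition injective_module (Q : lmodType R) : Prop :=
  forall (A B : lmodType R) (i : {linear A -> B}) (f : {linear A -> Q}),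
    injective i -> exists g : {linear B -> Q}, forall a, g (i a) = f a.

Definition essential (A H : lmodType R) (i : {linear A -> H}) : Prop :=
  forall W : submodule H, (exists2 w, w \in W & w != 0) ->
    exists2 a, i a \in W & i a != 0.

(* Injective hulls are unique only up to isomorphism, hence a predicate. *)
Definition injective_hull (A H : lmodType R) : Prop :=
  injective_module H /\
  exists i : {linear A -> H}, injective i /\ essential i.

Definition is_hull_family (H : maximal_ideal -> lmodType R) : Prop :=
  forall m : maximal_ideal, injective_hull (quotM m) (H m).

Definition matlis_dual (H : maximal_ideal -> lmodType R) (M : lmodType R) :
  lmodType R := homR M (prodM H).

End MatlisDuality.

(* Main.v *)
From HB Require Import structures.
Require Import Defs.
From mathcomp Require Import all_boot all_algebra.
From mathcomp Require Import boolp classical_sets.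

(** Both modules embed in [Hom(M, N)], and the two embeddings have the same
    image, namely the homomorphisms that vanish on [IM].

    On the torsion side, evaluation at the class of 1 embeds [Hom(R/I^k, L)] in
    [L] compatibly with the transition maps, hence embeds the colimit; the image
    consists of the elements killed by some power of [I]
    ([torsion_evaluation]).  For [L = Hom(M, N)] these are the [f] that vanish
    on [I^k M] for some [k].

    On the completion side, the point is that a coreduced module has
    [I^k M = IM] for all [k > 0] ([coreduced_power]).  Indeed [M/aM] is killed
    by [a], hence so is the isomorphic module [M/a^2 M], that is [aM = a^2 M];
    iterating, [aM = a^k M], which lies in [I^k M].  So the tower [M/I^k M] is
    constant from [k = 1] on, and the canonical map from [M] to its completion is
    onto with kernel [IM] ([to_completion_surj], [to_completion_kernel]).
    Precomposition with it embeds [Hom(Lambda_I M, N)] in [Hom(M, N)] with image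
    the [f] that vanish on [IM]; as the [I^k M] with [k > 0] coincide, this is
    the image found on the torsion side.

    The Matlis dual is [Hom(-, E)], so the second isomorphism is the first one
    for [N = E]. *)

Set Implicit Arguments.
Unset Strict Implicit.
Unset Printing Implicit Defensive.

Import GRing.Theory.
Local Open Scope ring_scope.
Local Open Scope quotient_scope.

(** * Linear maps and quotients *)

(** The isomorphism sends [a] to the unique [b] with [g b = f a]; injectivity
    of [g] makes it linear. *)
Lemma lmod_isom_same_image (R : pzRingType) (A B C : lmodType R)
    (f : {linear A -> C}) (g : {linear B -> C}) :
  injective f -> injective g ->
  (forall c, (exists a, f a = c) <-> (exists b, g b = c)) ->
  lmod_isom A B.
Proof.
move=> fI gI im.
have [h hE] : {h : A -> B & forall a, g (h a) = f a}.
  by apply: (@choice _ _ (fun a b => g b = f a)) => a; apply/im; exists a.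
have [h' h'E] : {h' : B -> A & forall b, f (h' b) = g b}.
  by apply: (@choice _ _ (fun b a => f a = g b)) => b; apply/im; exists b.
have h_linear : linear h.
  by move=> c x y; apply: gI; rewrite linearP !hE linearP.
exists (HB.pack h (GRing.isLinear.Build R A B *:%R h h_linear)
          : {linear A -> B}).
by exists h' => x; [apply: fI; rewrite h'E hE | apply: gI; rewrite hE h'E].
Qed.

Lemma quotM_eq0 (R : pzRingType) (V : lmodType R) (W : submodule V) (v : V) :
  (\pi_(quotM W) v == 0) = (v \in W).
Proof.
have -> : 0 = \pi_(quotM W) 0 by rewrite -(scale0r (0 : V)) quotM_piZ scale0r.
by rewrite quotM_eq subr0.
Qed.

Lemma quotM_lift (R : pzRingType) (V L : lmodType R) (W : submodule V)
    (f : {linear V -> L}) :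
  (forall w, w \in W -> f w = 0) ->
  exists g : {linear quotM W -> L}, forall v, g (\pi_(quotM W) v) = f v.
Proof.
move=> f0; pose g (x : quotM W) := f (repr x).
have gE v : g (\pi_(quotM W) v) = f v.
  by apply/eqP; rewrite -subr_eq0 -linearB f0 // -quotM_eq reprK.
have g_linear : linear g.
  move=> a; elim/quotW=> v; elim/quotW=> w.
  by rewrite -quotM_piZ -quotM_piD 3!gE linearP.
by exists (HB.pack g (GRing.isLinear.Build R (quotM W) L *:%R g g_linear)
             : {linear quotM W -> L}).
Qed.

Section KernelSubmodule.
Variables (R : pzRingType) (A B : lmodType R) (f : {linear A -> B}).

Definition kernel_pred : {pred A} := fun x => f x == 0.

Fact kernel_closed : GRing.subsemimod_closed kernel_pred.
Proof.
split; first split=> [|x y /eqP hx /eqP hy]; last move=> a x /eqP hx.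
- exact/eqP/linear0.
- by apply/eqP; rewrite linearD hx hy addr0.
- by apply/eqP; rewrite [LHS]linearZ hx /= scaler0.
Qed.

Definition kernelM : submodule A := HB.pack kernel_pred
  (GRing.isSubmodClosed.Build R A kernel_pred kernel_closed).

End KernelSubmodule.

(** Maps out of [V] that vanish on the products [a w] vanish on the submodule
    that these products generate, because a kernel is a submodule. *)
Lemma idealM_vanish (R : pzRingType) (V L : lmodType R) (J : ideal R)
    (W : submodule V) (f : {linear V -> L}) :
  (forall (a : R) w, a \in J -> w \in W -> f (a *: w) = 0) ->
  forall v, v \in idealM J W -> f v = 0.
Proof.
move=> f0 v vJW; apply/eqP.
apply: (spanM_sub (W := kernelM f) _ vJW) => _ [a [w [aJ wW ->]]].
exact/eqP/f0.
Qed.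

Lemma mem_idealM (R : pzRingType) (V : lmodType R) (J : ideal R)
    (W : submodule V) (a : R) w :
  a \in J -> w \in W -> a *: w \in idealM J W.
Proof. by move=> aJ wW; apply: mem_spanM; exists a, w. Qed.

(** * Sequential colimits *)

Section DirectLimitTheory.
Variables (R : pzRingType) (M : nat -> lmodType R).

Lemma dsumM_ext (x y : dsumM M) :
  (forall k, dsumM_val x k = dsumM_val y k) -> x = y.
Proof. by move=> e; apply: val_inj; apply: prodM_ext. Qed.

Lemma dsumM_valD (x y : dsumM M) k :
  dsumM_val (x + y) k = dsumM_val x k + dsumM_val y k.
Proof. by []. Qed.

Lemma dsumM_valZ a (x : dsumM M) k : dsumM_val (a *: x) k = a *: dsumM_val x k.
Proof. by []. Qed.

Lemma dsumM_valB (x y : dsumM M) k :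
  dsumM_val (x - y) k = dsumM_val x k - dsumM_val y k.
Proof. by []. Qed.

Lemma dsum_inj_in k (x : M k) : dsumM_val (dsum_inj x) k = x.
Proof. exact: dfwith_in. Qed.

Lemma dsum_inj_out k (x : M k) j : k != j -> dsumM_val (dsum_inj x) j = 0.
Proof. by move=> kj; rewrite /= dfwith_out. Qed.

Lemma dsum_injD k (x y : M k) : dsum_inj (x + y) = dsum_inj x + dsum_inj y.
Proof.
apply: dsumM_ext => j; rewrite dsumM_valD.
have [<-|kj] := eqVneq k j; first by rewrite !dsum_inj_in.
by rewrite !dsum_inj_out // addr0.
Qed.

Variable u : forall k, {linear M k -> M k.+1}.

Lemma dirlim_step k (x : M k) :
  \pi_(dirlim u) (dsum_inj x) = \pi_(dirlim u) (dsum_inj (u k x)) :> dirlim u.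
Proof. by apply/eqP; rewrite quotM_eq; apply: mem_spanM; exists k, x. Qed.

(** A direct sum element is pushed, component after component, to a
    level that bounds its support. *)
Lemma dirlim_level (z : dirlim u) :
  exists k (x : M k), z = \pi_(dirlim u) (dsum_inj x).
Proof.
elim/quotW: z => y; have /asboolP[n y0] := valP y.
suff: forall n y, (forall k, (n < k)%N -> dsumM_val y k = 0) ->
    exists x : M n, \pi_(dirlim u) y = \pi_(dirlim u) (dsum_inj x) :> dirlim u.
  move=> /(_ n y) [k nk|x ->]; first exact/y0/ltnW.
  by exists n, x.
move=> {n y y0}; elim=> [|n IHn] y y0.
  exists (dsumM_val y 0%N); congr (\pi_(dirlim u) _); apply: dsumM_ext => -[|k].
    by rewrite dsum_inj_in.
  by rewrite dsum_inj_out // y0.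
pose t := dsum_inj (dsumM_val y n.+1).
have [k nk|x xE] := IHn (y - t).
  rewrite dsumM_valB.
  have [<-|nk'] := eqVneq n.+1 k; first by rewrite dsum_inj_in subrr.
  by rewrite dsum_inj_out // y0 ?subr0 // ltn_neqAle nk'.
exists (u n x + dsumM_val y n.+1).
by rewrite -{1}(subrK t y) quotM_piD xE dirlim_step dsum_injD quotM_piD.
Qed.

Variables (L : lmodType R) (f : forall k, {linear M k -> L}).
Hypothesis f_cocone : forall k x, f k.+1 (u k x) = f k x.

(** A direct sum element is only known to have some bound on its support; the
    sum of the [f k (x k)] has the same value for all bounds. *)
Lemma sum_beyond_support (x : prodM M) m n :
    (forall k, (m <= k)%N -> x k = 0) -> (forall k, (n <= k)%N -> x k = 0) ->
  \sum_(k < m) f k (x k) = \sum_(k < n) f k (x k).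
Proof.
wlog mn : m n / (m <= n)%N => [H hm hn|hm _].
  by case/orP: (leq_total m n) => h; [|symmetry]; apply: H.
rewrite -!(big_mkord xpredT (fun k => f k (x k))).
rewrite (@big_cat_nat _ _ _ m 0 n) //=.
rewrite [X in _ + X]big_nat_cond [X in _ + X]big1 ?addr0 //.
move=> k /andP[/andP[mk _] _].
by rewrite hm // linear0.
Qed.

Lemma dsum_desc :
  exists g : {linear dsumM M -> L}, forall k x, g (dsum_inj x) = f k x.
Proof.
pose bnd (x : dsumM M) := projT1 (cid (asboolW (valP x))).
have bndP x : forall k, (bnd x <= k)%N -> dsumM_val x k = 0.
  exact: (projT2 (cid (asboolW (valP x)))).
pose g x := \sum_(k < bnd x) f k (dsumM_val x k).
have gE x n : (forall k, (n <= k)%N -> dsumM_val x k = 0) ->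
    g x = \sum_(k < n) f k (dsumM_val x k).
  by move=> xn; exact: sum_beyond_support (@bndP x) xn.
have g_linear : linear g.
  move=> a x y; pose n := maxn (bnd x) (bnd y).
  have xn k : (n <= k)%N -> dsumM_val x k = 0.
    by rewrite geq_max => /andP[xk _]; exact: bndP.
  have yn k : (n <= k)%N -> dsumM_val y k = 0.
    by rewrite geq_max => /andP[_ yk]; exact: bndP.
  rewrite (gE x n) // (gE y n) // (gE _ n) => [|k nk]; last first.
    by rewrite dsumM_valD dsumM_valZ xn // yn // scaler0 addr0.
  rewrite scaler_sumr -big_split; apply: eq_bigr => k _.
  by rewrite dsumM_valD dsumM_valZ linearP.
exists (HB.pack g (GRing.isLinear.Build R (dsumM M) L *:%R g g_linear)
          : {linear dsumM M -> L}).
move=> k x; rewrite [LHS](gE _ k.+1) => [|j kj].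
  rewrite big_ord_recr big1 => [|i _]; first by rewrite /= add0r dfwith_in.
  by rewrite dsum_inj_out ?linear0 // (gtn_eqF (ltn_ord i)).
by rewrite dsum_inj_out // ltn_eqF.
Qed.

Lemma dirlim_desc :
  exists g : {linear dirlim u -> L},
    forall k x, g (\pi_(dirlim u) (dsum_inj x)) = f k x.
Proof.
have [g gE] := dsum_desc.
have [w|h hE] := @quotM_lift _ _ _ (dirlim_rel u) g.
  move=> ww; apply/eqP; apply: (spanM_sub (W := kernelM g) _ ww).
  move=> _ [k [x ->]]; apply/eqP.
  by rewrite linearB !gE f_cocone subrr.
by exists h => k x; rewrite hE gE.
Qed.

(** Each element of the colimit comes from one level, so injectivity of the
    induced map can be tested level by level. *)
Lemma dirlim_embedding : (forall k, injective (f k)) ->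
  exists2 g : {linear dirlim u -> L}, injective g &
    forall c, (exists z, g z = c) <-> (exists k (x : M k), f k x = c).
Proof.
move=> fI; have [g gE] := dirlim_desc; exists g => [|c]; last first.
  split=> [[z <-]|[k [x <-]]]; last by exists (\pi_(dirlim u) (dsum_inj x)).
  by have [k [x ->]] := dirlim_level z; exists k, x.
suff g0 z : g z = 0 -> z = 0.
  move=> y z /eqP; rewrite -subr_eq0 -linearB => /eqP/g0/eqP.
  by rewrite subr_eq0 => /eqP.
have [k [x ->]] := dirlim_level z; rewrite gE -(linear0 (f k)) => /fI ->.
apply/eqP; rewrite quotM_eq0.
have -> : dsum_inj (0 : M k) = 0.
  by apply: (addrI (dsum_inj (0 : M k))); rewrite -dsum_injD !addr0.
exact: rpred0.
Qed.

End DirectLimitTheory.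

(** * The torsion functor *)

Section Torsion.
Variables (R : comPzRingType) (I : ideal R) (L : lmodType R).

Definition eval_fun (A : lmodType R) (x : A) (f : homR A L) : L := f x.

Fact eval_linear (A : lmodType R) (x : A) : linear (eval_fun x).
Proof. by []. Qed.

Definition eval (A : lmodType R) (x : A) : {linear homR A L -> L} :=
  HB.pack (eval_fun x)
    (GRing.isLinear.Build R (homR A L) L *:%R (eval_fun x) (eval_linear x)).

Definition orbit_fun (l : L) (r : R^o) : L := (r : R) *: l.

Fact orbit_linear l : linear (orbit_fun l).
Proof. by move=> a x y; rewrite /orbit_fun scalerDl scalerA. Qed.

Definition orbit_map (l : L) : {linear R^o -> L} := HB.pack (orbit_fun l)
  (GRing.isLinear.Build R R^o L *:%R (orbit_fun l) (orbit_linear l)).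

Lemma hom_cyclic (J : ideal R) (f : homR (quotM J) L) (r : R^o) :
  f (\pi_(quotM J) r) = (r : R) *: f (\pi_(quotM J) (1 : R^o)).
Proof. by rewrite -linearZ -quotM_piZ [(_ : R) *: _]mulr1. Qed.

(** Since [R/I^k] is cyclic, a homomorphism from it is an element of [L] killed
    by [I^k]. *)
Lemma torsion_evaluation :
  exists2 ev : {linear torsion_functor I L -> L}, injective ev &
    forall l, (exists z, ev z = l) <->
      (exists k, forall a : R, a \in idealX I k -> a *: l = 0).
Proof.
pose f k := eval (\pi_(quotM (idealX I k)) (1 : R^o)).
have fI k : injective (f k).
  move=> x y xy; apply: Hom_ext; elim/quotW=> r.
  by rewrite hom_cyclic [RHS]hom_cyclic; congr (_ *: _); exact: xy.
have f_cocone k x :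
    f k.+1 (precomp L (quot_proj (@idealX_sub R I k)) x) = f k x.
  by rewrite /= /eval_fun /= (quot_proj_pi (@idealX_sub R I k)).
have [ev evI evE] := dirlim_embedding f_cocone fI.
exists ev => // l; split=> [/evE[k [x <-]]|[k l0]].
  exists k => a aI; rewrite [f k x]/(x _) -hom_cyclic.
  have /eqP -> : \pi_(quotM (idealX I k)) a == 0 by rewrite quotM_eq0.
  exact: linear0.
have [g gE] := @quotM_lift _ _ _ (idealX I k) (orbit_map l) l0.
by apply/evE; exists k, g; exact: etrans (gE _) (scale1r l).
Qed.

End Torsion.

(** * Coreduced modules and completion *)

Section Coreduced.
Variables (R : comPzRingType) (I : ideal R) (M : lmodType R).
Hypothesis coredM : coreduced I M.

(** The hypothesis is an abstract isomorphism between [M/aM] and [M/a^2 M], but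
    being killed by [a] is invariant under isomorphism, so [aM] lies in
    [a^2 M]. *)
Lemma coreduced_square a (m : M) :
  a \in I -> exists m', a *: m = a *: (a *: m').
Proof.
move=> /coredM [phi [psi _ phiK]].
pose q : cokerM (homothety M a \o homothety M a) := \pi_(quotM _) m.
have aq : a *: q = 0.
  (* [q] is the image under [phi] of an element of [M/aM]. *)
  rewrite -[q]phiK -linearZ; move: (psi q); elim/quotW=> v.
  rewrite -quotM_piZ.
  set z := \pi_(_) _; suff /eqP -> : z == 0 by rewrite linear0.
  by rewrite quotM_eq0; apply/asboolP; exists v.
move/eqP: aq; rewrite -quotM_piZ quotM_eq0 => /asboolP[m' am].
by exists m'.
Qed.

Lemma mem_idealX_exp a k : a \in I -> (a ^+ k : R^o) \in idealX I k.
Proof. by move=> aI; elim: k => // k IHk; rewrite exprS mem_idealM. Qed.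

(** Iterating [aM = a^2 M] gives [aM = a^(k+1) M] for each [a] in [I]. *)
Lemma coreduced_power k :
  idealM (idealX I k.+1) (fullM M) =i idealM I (fullM M).
Proof.
move=> v; apply/idP/idP; last first.
  apply: spanM_sub => _ [a [m [aI _ ->]]].
  have [m' ->] : exists m', a *: m = a ^+ k.+1 *: m'.
    elim: k m => [|k IHk] m; first by exists m; rewrite expr1.
    have [m1 ->] := coreduced_square m aI; have [m2 ->] := IHk m1.
    by exists m2; rewrite scalerA -exprS.
  by rewrite mem_idealM ?mem_idealX_exp.
apply: idealMS v; apply: spanM_sub => _ [a [r [aI _ ->]]].
by rewrite [_ *: _]mulrC; apply: (rpredZ (r : R)).
Qed.

(** [I^0] is the unit ideal, so the level [k = 0] of the tower is zero. *)
Lemma mem_idealM_full (m : M) : m \in idealM (idealX I 0) (fullM M).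
Proof. by rewrite -[m]scale1r mem_idealM. Qed.

Definition completion_level k : lmodType R :=
  quotM (idealM (idealX I k) (fullM M)).

Definition to_completion_seq (m : M) : prodM completion_level :=
  fun k => \pi_(quotM _) m.

Fact to_completion_coherent m :
  to_completion_seq m \in
    @coherent R completion_level
      (fun k => quot_proj (idealMS (W := fullM M) (@idealX_sub R I k))).
Proof.
by apply/asboolP => k; rewrite /= (quot_proj_pi (idealMS (@idealX_sub R I k))).
Qed.

Definition to_completion_fun (m : M) : completion_functor I M :=
  InvLim (to_completion_coherent m).

Fact to_completion_linear : linear to_completion_fun.
Proof.
move=> a x y; apply: val_inj; apply: prodM_ext => k.
by rewrite /= /to_completion_seq quotM_piD quotM_piZ.
Qed.

Definition to_completion : {linear M -> completion_functor I M} :=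
  HB.pack to_completion_fun
    (GRing.isLinear.Build R M (completion_functor I M) *:%R to_completion_fun
       to_completion_linear).

(** A coherent sequence is determined by its term at [k = 1]: the term at
    [k = 0] lies in the zero module [M/M], and above [k = 1] the transition
    maps are injective. *)
Lemma to_completion_surj (x : completion_functor I M) :
  exists m, to_completion m = x.
Proof.
have xC k : quot_proj (idealMS (W := fullM M) (@idealX_sub R I k))
    (invlim_val x k.+1) = invlim_val x k.
  by have /asboolP := valP x; exact.
have [m mE] : exists m, \pi_(quotM _) m = invlim_val x 1%N.
  by elim/quotW: (invlim_val x 1%N) => m; exists m.
exists m; apply: val_inj; apply: prodM_ext.
change (forall k, to_completion_seq m k = invlim_val x k).
rewrite /to_completion_seq => -[|k].
  elim/quotW: (invlim_val x 0%N) => v.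
  by apply/eqP; rewrite quotM_eq mem_idealM_full.
elim: k => [//|k IHk].
have := xC k.+1; rewrite -IHk; elim/quotW: (invlim_val x k.+2) => v.
rewrite [LHS](quot_proj_pi (idealMS (@idealX_sub R I k.+1))) => /eqP.
rewrite eq_sym quotM_eq coreduced_power => mv.
by apply/eqP; rewrite quotM_eq coreduced_power.
Qed.

Lemma to_completion_kernel m :
  (to_completion m = 0) <-> m \in idealM I (fullM M).
Proof.
split=> [m0|mI].
  rewrite -(coreduced_power 0) -quotM_eq0.
  have -> : \pi_(quotM _) m = invlim_val (to_completion m) 1%N by [].
  by rewrite m0.
apply: val_inj; apply: prodM_ext => k; apply/eqP.
rewrite [_ == _](quotM_eq0 _ m).
by case: k => [|k]; rewrite ?mem_idealM_full // coreduced_power.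
Qed.

(** A homomorphism [f] that vanishes on [IM] extends along [to_completion] by
    [x |-> f (s x)], with [s] any set-theoretic section; two lifts of [x] differ
    by an element of [IM], so the extension is linear even if [s] is not. *)
Lemma hom_completion (N : lmodType R) :
  exists2 p : {linear homR (completion_functor I M) N -> homR M N},
    injective p &
    forall f, (exists h, p h = f) <->
      (forall m, m \in idealM I (fullM M) -> f m = 0).
Proof.
exists (precomp N to_completion) => [h h' hh'|f].
  apply: Hom_ext => x; have [m <-] := to_completion_surj x.
  exact: (congr1 (fun g : homR M N => g m) hh').
split=> [[h <-] m /to_completion_kernel m0|f0].
  exact: etrans (congr1 h m0) (linear0 h).
have [s sE] : {s & forall x, to_completion (s x) = x}.
  apply: (@choice _ _ (fun x m => to_completion m = x)).
  exact: to_completion_surj.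
have hE m : f (s (to_completion m)) = f m.
  apply/eqP; rewrite -subr_eq0 -linearB f0 //.
  by apply/to_completion_kernel; rewrite linearB sE subrr.
have h_linear : linear (f \o s).
  move=> a x y; rewrite -{1}(sE x) -{1}(sE y) -linearP /=.
  by rewrite hE linearP.
exists (HB.pack (f \o s) (GRing.isLinear.Build R (completion_functor I M) N
          *:%R (f \o s) h_linear) : {linear completion_functor I M -> N}).
by apply: Hom_ext => m; exact: hE.
Qed.

(** For [k = 0] the left side says [f = 0]; for every [k > 0] it says that [f]
    vanishes on [I^k M], which is [IM]. *)
Lemma hom_killed_by_power (N : lmodType R) (f : homR M N) :
  (exists k, forall a : R, a \in idealX I k -> a *: f = 0) <->
  (forall m, m \in idealM I (fullM M) -> f m = 0).
Proof.
split=> [[k fk]|f0].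
  move=> m; rewrite -(coreduced_power k).
  apply: (@idealM_vanish _ _ _ _ _ f) => a v /idealX_sub aI _.
  by rewrite linearZ; exact: (congr1 (fun g : homR M N => g v) (fk a aI)).
exists 1%N => a aI; apply: Hom_ext => m.
transitivity (f (a *: m)); first by rewrite linearZ.
by apply: f0; rewrite -(coreduced_power 0) mem_idealM.
Qed.

End Coreduced.

Lemma torsion_hom_isom (R : comPzRingType) (I : ideal R) (M N : lmodType R) :
  coreduced I M ->
  lmod_isom (torsion_functor I (homR M N)) (homR (completion_functor I M) N).
Proof.
move=> coredM.
have [ev evI evE] := torsion_evaluation I (homR M N).
have [p pI pE] := hom_completion coredM N.
apply: (lmod_isom_same_image evI pI) => f.
by rewrite evE pE; apply: hom_killed_by_power.
Qed.

Theorem proposition5p2 (R : comPzRingType) (I : ideal R) (M N : lmodType R)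
    (coredM : coreduced I M) :
  lmod_isom (torsion_functor I (homR M N)) (homR (completion_functor I M) N) /\
  (forall H : maximal_ideal R -> lmodType R, is_hull_family H ->
     lmod_isom (torsion_functor I (matlis_dual H M))
               (matlis_dual H (completion_functor I M))).
Proof. by split=> [|H _]; exact: torsion_hom_isom. Qed.
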